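(* Suppose that $\mu,\mu^*$ are finite positive Borel measures with $\mu\le\mu^*$ in $[-1,1]$. Then for all $x,y\in[-1,1]$ and $n\ge1$, $$\frac{\left|K_n(x,y)-K_n^*(x,y)\right|}{K_n(x,x)}\le\left(\frac{K_n(y,y)}{K_n(x,x)}\right)^{1/2}\left[1-\frac{K_n^*(x,x)}{K_n(x,x)}\right]^{1/2}=\left(\frac{\lambda_n(x)}{\lambda_n(y)}\right)^{1/2}\left[1-\frac{\lambda_n(x)}{\lambda_n^*(x)}\right]^{1/2}.$$
   Context: All measures are supported in $[-1,1]$ and have infinite support. For a measure $\mu$, $p_k$ ($k\ge0$) denotes its orthonormal polynomial of degree $k$ with positive leading coefficient, $\int_{-1}^1p_kp_m\,d\mu=\delta_{km}$; $K_n(x,y)=\sum_{k=0}^{n-1}p_k(x)p_k(y)$ is its reproducing kernel, and $\lambda_n(x)=1/K_n(x,x)=\min_{\deg P\le n-1}\left(\int_{-1}^1P^2\,d\mu\right)/P^2(x)$ is its $n$th Christoffel function. $K_n^*$ and $\lambda_n^*$ denote the corresponding quantities for $\mu^*$. The relation $\mu\le\mu^*$ means $\mu(E)\le\mu^*(E)$ for all Borel sets $E\subset[-1,1]$. *)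

(* Defs.v *)
From HB Require Import structures.
From mathcomp Require Import all_boot all_order all_algebra.
From mathcomp Require Import all_classical all_reals all_analysis.

Set Implicit Arguments.
Unset Strict Implicit.
Unset Printing Implicit Defensive.

Import Order.TTheory GRing.Theory Num.Theory.
Import numFieldNormedType.Exports.

Local Open Scope classical_set_scope.
Local Open Scope ring_scope.

(* Finite positive Borel measures on the real line; [measurableTypeR R] is R
   with its Borel sigma-algebra. *)
Notation borel_measure R :=
  {finite_measure set (measurableTypeR R) -> \bar R}.

Section OrthogonalPolynomials.
Variable R : realType.
Implicit Types (mu nu : borel_measure R) (p : nat -> {poly R}).

Definition supported_in mu (D : set R) : Prop := mu (~` D) = 0%E.

Definition msupport mu : set R :=
  [set x | forall U : set R, open U -> U x -> (0 < mu U)%E].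

Definition le_measure_on (D : set R) mu nu : Prop :=
  forall E : set (measurableTypeR R),
    measurable E -> E `<=` D -> (mu E <= nu E)%E.

Definition orthonormal_system mu p : Prop :=
  (forall k, size (p k) = k.+1 /\ 0 < lead_coef (p k)) /\
  (forall k m,
     \int[mu]_(x in `[-1, 1]) ((p k).[x] * (p m).[x]) = (k == m)%:R).

(* The orthonormal system exists and is unique when mu is supported in
   [-1, 1] and has infinite support; the default value is irrelevant then. *)
Definition orthopoly mu : nat -> {poly R} :=
  xget (fun=> 0) [set p | orthonormal_system mu p].

Definition repro_kernel mu (n : nat) (x y : R) : R :=
  \sum_(k < n) (orthopoly mu k).[x] * (orthopoly mu k).[y].

Definition christoffel mu (n : nat) (x : R) : R := (repro_kernel mu n x x)^-1.

End OrthogonalPolynomials.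

(* Main.v *)
Require Import Defs.
From HB Require Import structures.
From mathcomp Require Import all_boot all_order all_algebra.
From mathcomp Require Import all_classical all_reals all_analysis.
From mathcomp Require Import measurable_realfun ring lra.
Import Order.TTheory GRing.Theory Num.Theory.
Import numFieldNormedType.Exports.
Local Open Scope classical_set_scope.
Local Open Scope ring_scope.

Set Implicit Arguments.
Unset Strict Implicit.

(* The kernel section [K_n(x, .)] reproduces polynomials of degree less than
   [n], so expanding the square and using [mu <= mu^*] gives
   [\int (K_n(x, .) - K_n^*(x, .))^2 dmu <= K_n(x, x) - K_n^*(x, x)].  The
   value at [y] of a polynomial [P] of degree less than [n] satisfies
   [P(y)^2 <= K_n(y, y) \int P^2 dmu]; apply this to
   [P = K_n(x, .) - K_n^*(x, .)]. *)

(** Subtracting the multiple of [p n] that cancels the coefficient of degree [n] lowers the size, so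
    induction applies. *)
Lemma size_basis_expansion (F : fieldType) (p : nat -> {poly F}) :
  (forall k, size (p k) = k.+1) ->
  forall n (P : {poly F}), (size P <= n)%N ->
  exists c : nat -> F, P = \sum_(k < n) c k *: p k.
Proof.
move=> size_p; elim=> [|n IHn] P.
  by rewrite leqn0 size_poly_eq0 => /eqP ->; exists (fun=> 0); rewrite big_ord0.
move=> leP; pose a := P`_n / (p n)`_n.
have pn0 : (p n)`_n != 0.
  have := lead_coef_eq0 (p n); rewrite lead_coefE size_p /= => ->.
  by rewrite -size_poly_eq0 size_p.
have [|c Pc] := IHn (P - a *: p n).
  apply/leq_sizeP => j; rewrite leq_eqVlt => /predU1P[<-|ltj].
    by rewrite coefB coefZ /a divfK ?subrr.
  rewrite coefB coefZ !nth_default ?mulr0 ?subrr ?size_p //.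
  exact: leq_trans leP ltj.
exists (fun k => if k == n then a else c k).
rewrite big_ord_recr /= eqxx -[LHS](subrK (a *: p n)) Pc; congr (_ + _).
by apply: eq_bigr => k _; rewrite ltn_eqF.
Qed.

Section ReproducingKernel.
Variables (R : realFieldType) (I : {scalar {poly R}}) (n : nat).

(** Here [I] plays the role of integration against the measure, and [k] that of the one-variable
    section [K_n(x, .)]. *)
Definition reproduces (k : {poly R}) (x : R) :=
  forall P : {poly R}, (size P <= n)%N -> I (P * k) = P.[x].

Lemma orthonormal_reproduces (p : nat -> {poly R}) (x : R) :
  (forall k, size (p k) = k.+1) ->
  (forall k m, I (p k * p m) = (k == m)%:R) ->
  reproduces (\sum_(k < n) (p k).[x] *: p k) x.
Proof.
move=> size_p orth P /(size_basis_expansion size_p)[c ->].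
rewrite mulr_suml linear_sum horner_sum; apply: eq_bigr => k _ /=.
rewrite mulr_sumr linear_sum (bigD1 k) //= big1 => [|j neq_jk].
  by rewrite addr0 -scalerAl -scalerAr !linearZ /= orth eqxx hornerZ mulr1.
rewrite -scalerAl -scalerAr !linearZ /= orth.
by rewrite (inj_eq val_inj) eq_sym (negbTE neq_jk) !mulr0.
Qed.

Hypothesis I_ge0 : forall P, 0 <= I (P * P).

(** Cauchy-Schwarz for the semidefinite form [I (P * Q)], since [P.[y] = I (P * k)] and [k.[y] = I
    (k * k)]: the quadratic [I ((P - t *: k) * (P - t *: k))] is nonnegative for every [t]. *)
Lemma sqr_horner_le (k P : {poly R}) (y : R) :
  (size k <= n)%N -> reproduces k y -> (size P <= n)%N ->
  P.[y] ^+ 2 <= k.[y] * I (P * P).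
Proof.
move=> size_k rep_k size_P.
have quad t : 0 <= I (P * P) - 2 * t * P.[y] + t ^+ 2 * k.[y].
  have -> : I (P * P) - 2 * t * P.[y] + t ^+ 2 * k.[y]
            = I ((P - t *: k) * (P - t *: k)).
    rewrite -(rep_k _ size_P) -(rep_k _ size_k).
    have -> : (P - t *: k) * (P - t *: k)
              = P * P - (2 * t) *: (P * k) + t ^+ 2 *: (k * k).
      by rewrite -!mul_polyC rmorphM rmorphXn rmorph_nat /=; ring.
    by rewrite linearD linearB !linearZ.
  exact: I_ge0.
have ky_ge0 : 0 <= k.[y] by rewrite -rep_k.
have [ky0|ky_neq0] := eqVneq k.[y] 0; last first.
  have ky_gt0 : 0 < k.[y] by rewrite lt_def ky_neq0.
  (* This [t] minimises the quadratic. *)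
  have := mulr_ge0 ky_ge0 (quad (P.[y] / k.[y])).
  have -> : k.[y] * (I (P * P) - 2 * (P.[y] / k.[y]) * P.[y]
              + (P.[y] / k.[y]) ^+ 2 * k.[y])
            = k.[y] * I (P * P) - P.[y] ^+ 2 by field.
  by rewrite subr_ge0.
rewrite ky0 mul0r; have [->|Py0] := eqVneq P.[y] 0; first by rewrite expr0n.
(* With [k.[y] = 0] the quadratic is affine in [t]; this [t] gives it the value -1, a
   contradiction. *)
have := quad ((I (P * P) + 1) / (2 * P.[y])).
have -> : 2 * ((I (P * P) + 1) / (2 * P.[y])) * P.[y] = I (P * P) + 1.
  by field; rewrite Py0.
rewrite ky0; lra.
Qed.

(* [k] and [l] are the kernel sections at [x] and [y], and [g] is the kernel
   section at [x] for the larger functional [J]. *)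
Lemma reproducing_kernel_comparison (J : {scalar {poly R}})
    (k l g : {poly R}) (x y : R) :
  (forall P, I (P * P) <= J (P * P)) ->
  (size k <= n)%N -> (size l <= n)%N -> (size g <= n)%N ->
  reproduces k x -> reproduces l y -> J (g * g) = g.[x] ->
  (k.[y] - g.[y]) ^+ 2 <= l.[y] * (k.[x] - g.[x]).
Proof.
move=> le_IJ size_k size_l size_g rep_k rep_l Jg.
have size_kg : (size (k - g)%R <= n)%N.
  by rewrite (leq_trans (size_polyD _ _)) // geq_max size_polyN size_k.
rewrite -hornerN -hornerD.
apply: le_trans (sqr_horner_le size_l rep_l size_kg) _.
apply: ler_wpM2l; first by rewrite -rep_l.
have -> : (k - g) * (k - g) = k * k - 2 *: (g * k) + g * g.
  by rewrite -!mul_polyC rmorph_nat; ring.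
rewrite linearD linearB linearZ /= !rep_k //.
(* The integral is now [k.[x] - 2 * g.[x] + I (g * g)], and [I (g * g) <= J (g * g) = g.[x]]. *)
have := le_IJ g; rewrite Jg; lra.
Qed.

End ReproducingKernel.

(** Restricting both measures to [D] turns the comparison on subsets of [D] into one on all
    measurable sets. *)
Lemma ge0_le_on_integral d (T : measurableType d) (R : realType)
    (m1 m2 : {measure set T -> \bar R}) (D : set T) (f : T -> \bar R) :
  measurable D ->
  (forall E, measurable E -> E `<=` D -> (m1 E <= m2 E)%E) ->
  (forall x, (0 <= f x)%E) -> measurable_fun [set: T] f ->
  (\int[m1]_(x in D) f x <= \int[m2]_(x in D) f x)%E.
Proof.
move=> mD le_m f0 mf.
have restrE (m : {measure set T -> \bar R}) :
    (\int[m]_(x in D) f x = \int[mrestr m mD]_(x in D) f x)%E.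
  by apply: eq_measure_integral => A mA AD; rewrite /= /mrestr setIidl.
rewrite (restrE m1) (restrE m2); apply: ge0_le_measure_integral => // S mS.
by apply: le_m; [exact: measurableI | exact: subIsetr].
Qed.

Section PolynomialIntegral.
Variable R : realType.
Implicit Types (mu nu : borel_measure R) (P : {poly R}).

(** A polynomial is bounded on the compact interval, which has finite measure. *)
Lemma integrable_horner mu P :
  mu.-integrable `[-1, 1] (EFin \o (horner P : measurableTypeR R -> R)).
Proof.
apply: measurable_bounded_integrable.
- exact: measurable_itv.
- by rewrite ltey_eq fin_num_measure //; exact: measurable_itv.
- exact: measurable_poly.
have cont : {within `[-1, 1], continuous (horner P : R -> R^o)}.
  exact/continuous_subspaceT/continuous_horner.
have /compact_bounded[M [_ mrt]] :=
  continuous_compact cont (@segment_compact R (-1) 1).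
by exists M; split; rewrite ?num_real // => ? ? ? ?; exact: mrt.
Qed.

Definition poly_integral mu P : R := \int[mu]_(x in `[-1, 1]) P.[x].

Lemma poly_integral_is_scalar mu : scalar (poly_integral mu).
Proof.
move=> a P Q; rewrite /poly_integral.
under eq_Rintegral do rewrite hornerD hornerZ.
rewrite RintegralD ?RintegralZl //; try exact: integrable_horner.
rewrite (_ : (fun x => _) = horner (a *: P)); first exact: integrable_horner.
by apply/funext => x; rewrite hornerZ.
Qed.

HB.instance Definition _ mu :=
  GRing.isLinear.Build R {poly R} R *%R (poly_integral mu)
    (poly_integral_is_scalar mu).

Lemma poly_integral_sqr_ge0 mu P : 0 <= poly_integral mu (P * P).
Proof. by apply: Rintegral_ge0 => x _; rewrite hornerM -expr2 sqr_ge0. Qed.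

Lemma le_poly_integral_sqr mu nu P : le_measure_on `[-1, 1] mu nu ->
  poly_integral mu (P * P) <= poly_integral nu (P * P).
Proof.
move=> le_mn; apply: fine_le.
- exact: integrable_fin_num (integrable_horner mu (P * P)).
- exact: integrable_fin_num (integrable_horner nu (P * P)).
apply: ge0_le_on_integral => // [x|].
  by rewrite lee_fin hornerM -expr2 sqr_ge0.
by apply/measurable_EFinP; exact: measurable_poly.
Qed.

Definition kernel_section mu n (x : R) : {poly R} :=
  \sum_(k < n) (orthopoly mu k).[x] *: orthopoly mu k.

Lemma horner_kernel_section mu n (x y : R) :
  (kernel_section mu n x).[y] = repro_kernel mu n x y.
Proof. by rewrite horner_sum; apply: eq_bigr => k _; rewrite hornerZ. Qed.

(* In the default case the kernel sections are [0]; for [mu] the quotients by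
   [K_n(x, x)] are then [0], and for [mu^*] the identity
   [\int K_n^*(x, .)^2 dmu^* = K_n^*(x, x)] still holds.  Hence no Gram-Schmidt
   construction is needed. *)
Variant orthopoly_spec mu : Prop :=
  | OrthopolySystem of orthonormal_system mu (orthopoly mu)
  | OrthopolyDefault of orthopoly mu = fun=> 0.

Lemma orthopolyP mu : orthopoly_spec mu.
Proof.
rewrite /orthopoly; have [[p sys_p]|nsys] :=
  pselect (exists p, orthonormal_system mu p).
  by left; apply: xgetPex; exists p.
by right; apply: xgetPN => p sys_p; apply: nsys; exists p.
Qed.

Lemma size_kernel_section mu n (x : R) : (size (kernel_section mu n x) <= n)%N.
Proof.
apply: (leq_trans (size_sum _ _ _)); apply/bigmax_leqP => k _.
apply: leq_trans (size_scale_leq _ _) _.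
by case: (orthopolyP mu) => [[/(_ k)[-> _] _]|->]; rewrite ?size_poly0.
Qed.

Lemma kernel_section_reproduces mu n (x : R) :
  orthonormal_system mu (orthopoly mu) ->
  reproduces (poly_integral mu) n (kernel_section mu n x) x.
Proof.
move=> [deg orth]; apply: orthonormal_reproduces => [k|k m].
  by have [] := deg k.
by rewrite -orth; apply: eq_Rintegral => z _; rewrite hornerM.
Qed.

Lemma poly_integral_kernel_section_sqr mu n (x : R) :
  poly_integral mu (kernel_section mu n x * kernel_section mu n x)
  = (kernel_section mu n x).[x].
Proof.
case: (orthopolyP mu) => [/kernel_section_reproduces rep|def].
  by rewrite rep // size_kernel_section.
have -> : kernel_section mu n x = 0.
  by rewrite /kernel_section def big1 // => k _; rewrite scaler0.
by rewrite mul0r linear0 horner0.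
Qed.

Lemma repro_kernel_ge0 mu n (x : R) : 0 <= repro_kernel mu n x x.
Proof. by apply: sumr_ge0 => k _; rewrite -expr2 sqr_ge0. Qed.

(** A nonzero kernel value excludes the default case. *)
Lemma repro_kernel_neq0_system mu n (x y : R) : repro_kernel mu n x y != 0 ->
  orthonormal_system mu (orthopoly mu).
Proof.
case: (orthopolyP mu) => // def; rewrite /repro_kernel def big1 ?eqxx // => k _.
by rewrite horner0 mul0r.
Qed.

End PolynomialIntegral.

Unset Implicit Arguments.
Set Strict Implicit.

Theorem mainTheorem7 (R : realType) (mu mus : borel_measure R)
  (mu_supp : supported_in mu `[-1, 1]) (mus_supp : supported_in mus `[-1, 1])
  (mu_inf : infinite_set (msupport mu)) (mus_inf : infinite_set (msupport mus))
  (le_mu : le_measure_on `[-1, 1] mu mus)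
  (x y : R) (hx : x \in `[-1, 1]) (hy : y \in `[-1, 1])
  (n : nat) (hn : (1 <= n)%N) :
  let K := repro_kernel mu n in
  let Ks := repro_kernel mus n in
  let lam := christoffel mu n in
  let lams := christoffel mus n in
  `|K x y - Ks x y| / K x x
    <= Num.sqrt (K y y / K x x) * Num.sqrt (1 - Ks x x / K x x)
  /\ Num.sqrt (K y y / K x x) * Num.sqrt (1 - Ks x x / K x x)
     = Num.sqrt (lam x / lam y) * Num.sqrt (1 - lam x / lams x).
Proof.
move=> K Ks lam lams; split; last first.
  by rewrite /lam /lams /christoffel !invrK [_^-1 * _]mulrC [_^-1 * Ks _ _]mulrC.
(* Division by zero yields 0, so for [K x x = 0] the left side vanishes and the right side is a
   product of square roots. *)
have [Kx0|Kx_neq0] := eqVneq (K x x) 0.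
  by rewrite Kx0 !invr0 !mulr0 mulr_ge0 ?sqrtr_ge0.
have Kx_gt0 : 0 < K x x by rewrite lt_def Kx_neq0 repro_kernel_ge0.
have sys := repro_kernel_neq0_system Kx_neq0.
have := @reproducing_kernel_comparison _ (poly_integral mu) n
  (poly_integral_sqr_ge0 mu) (poly_integral mus) _ _ _ x y
  (fun P => le_poly_integral_sqr P le_mu)
  (size_kernel_section mu n x) (size_kernel_section mu n y)
  (size_kernel_section mus n x) (kernel_section_reproduces x sys)
  (kernel_section_reproduces y sys) (poly_integral_kernel_section_sqr mus n x).
rewrite !horner_kernel_section -/K -/Ks => le_sqr.
(* Both sides are written as single square roots; comparing the radicands leaves [le_sqr] divided by
   [K x x ^+ 2]. *)
rewrite -sqrtrM ?divr_ge0 ?repro_kernel_ge0 //.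
rewrite -[X in _ / X]gtr0_norm // -normf_div -sqrtr_sqr ler_wsqrtr //.
have -> : K y y / K x x * (1 - Ks x x / K x x)
          = K y y * (K x x - Ks x x) / K x x ^+ 2 by field.
by rewrite expr_div_n ler_wpM2r // invr_ge0 sqr_ge0.
Qed.
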